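(* Let $M$ be a von Neumann algebra with separable predual. Let $\mathcal G_{w*}(M)$ denote its space of ultraweakly closed vector subspaces, endowed with the Vietoris topology, and endow the closed unit ball $(M)_1$ with the weak topology. There is a sequence of continuous maps $x_n:\mathcal G_{w*}(M)\to (M)_1$ such that for all $V\in\mathcal G_{w*}(M)$, the sequence $(x_n(V))_{n\in\mathbb N}$ is dense in $(V)_1$ for the weak topology.
   Context: For a normed space $V$, $(V)_1$ denotes its closed unit ball. The ultraweak topology on $M$ is the weak-$*$ topology $\sigma(M,M_* )$. The weak topology is the weak operator topology; on $(M)_1$ it coincides with the ultraweak topology, and $(M)_1$ is compact Hausdorff for it. For a compact Hausdorff space $X$, the Vietoris topology on the set $\mathcal F(X)$ of closed subsets of $X$ is generated by the sets $\{F: F\cap U\neq\emptyset\}$ and $\{F: F\subseteq U\}$ for $U\subseteq X$ open. A subspace $V\in\mathcal G_{w*}(M)$ is identified with its closed unit ball $(V)_1\in\mathcal F((M)_1)$, and the Vietoris topology on $\mathcal G_{w*}(M)$ is the one induced from $\mathcal F((M)_1)$. That $(x_n(V))_n$ is dense in $(V)_1$ means that all $x_n(V)$ belong to $(V)_1$ and form a dense subset of it. *)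

(* Defs.v *)
From HB Require Import structures.
From mathcomp Require Import all_boot all_order all_algebra.
From mathcomp Require Import sesquilinear complex.
From mathcomp Require Import all_classical all_reals all_analysis.

Set Implicit Arguments.
Unset Strict Implicit.
Unset Printing Implicit Defensive.

Import Order.TTheory GRing.Theory Num.Theory.
Import numFieldNormedType.Exports.

Local Open Scope classical_set_scope.
Local Open Scope ring_scope.

(* The scalar field is C = R[i] for a realType R. Norms in a normedModType over
   R[i] are (nonnegative real) elements of R[i]; [Re] brings them back to R.
   As a topological space C is written R[i]^o. *)

(* A complex Hilbert space is a complete normed space over R[i] whose norm comes
   from an inner product, linear in the first variable and conjugate-linear in
   the second one. *)
Definition norm_of_dot (R : realType) (H : completeNormedModType R[i])
    (dot : {dot H for Num.conj}) : Prop :=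
  forall u : H, `|u| ^+ 2 = dot u u.

Section BoundedOperators.
Variables (R : realType) (H : completeNormedModType R[i]).

Definition bounded_op : {pred H -> H} :=
  mem [set T : H -> H | linear T /\ continuous T].

Fact bounded_op_submod : submod_closed bounded_op.
Proof.
split.
  by apply/mem_set; split=> [a u v|u]; rewrite ?scaler0 ?addr0//; exact: cvg_cst.
move=> a S T /set_mem [lS cS] /set_mem [lT cT]; apply/mem_set; split=> [b u v|u].
  change (a *: S (b *: u + v) + T (b *: u + v) =
    b *: (a *: S u + T u) + (a *: S v + T v)).
  rewrite lS lT !scalerDr !scalerA mulrC -!addrA; congr (_ + _).
  by rewrite addrCA.
apply: (@cvgD _ _ _ _ _ (fun u => a *: S u) T); last exact: cT.
by apply: cvgZl_tmp; exact: cS.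
Qed.

HB.instance Definition _ :=
  GRing.isSubmodClosed.Build _ _ bounded_op bounded_op_submod.

(* B(H) *)
Record bop := Bop { bop_fun :> H -> H; bopP : bop_fun \in bounded_op }.

HB.instance Definition _ := [isSub for bop_fun].
HB.instance Definition _ := [Choice of bop by <:].
HB.instance Definition _ := [SubChoice_isSubLmodule of bop by <:].

Fact bop1_subproof : (idfun : H -> H) \in bounded_op.
Proof. by apply/mem_set; split=> // u; exact: cvg_id. Qed.

Definition bop1 : bop := Bop bop1_subproof.

Fact bop_comp_subproof (S T : bop) : (S \o T : H -> H) \in bounded_op.
Proof.
have [/set_mem[lS cS] /set_mem[lT cT]] := (bopP S, bopP T).
apply/mem_set; split=> [a u v /=|u]; first by rewrite lT lS.
by apply: continuous_comp; [exact: cT|exact: cS].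
Qed.

Definition bop_comp (S T : bop) : bop := Bop (bop_comp_subproof S T).

Definition opnorm (T : bop) : R :=
  sup [set complex.Re `|T u| | u in [set u : H | `|u| <= 1]].

End BoundedOperators.

Section VonNeumann.
Variables (R : realType) (H : completeNormedModType R[i]).
Variable dot : {dot H for Num.conj}.
Local Notation C := (R[i]^o).

Definition is_adjoint (S T : bop H) : Prop :=
  forall u v : H, dot (S u) v = dot u (T v).

Definition matrix_coef (T : bop H) : {ptws H * H -> C} :=
  fun p => dot (T p.1) p.2.

(* B(H) with the weak operator topology *)
Definition wot : Type := initial_topology matrix_coef.
HB.instance Definition _ := Topological.on wot.

Definition is_subspace (V : set (bop H)) : Prop :=
  V 0 /\ forall (a : R[i]) (x y : bop H), V x -> V y -> V (a *: x + y).

Record von_neumann_algebra (M : set (bop H)) : Prop := VonNeumannAlgebra {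
  vna_subspace : is_subspace M;
  vna_comp : forall x y, M x -> M y -> M (bop_comp x y);
  vna_id : M (bop1 H);
  vna_adjoint : forall x, M x -> exists2 y, M y & is_adjoint x y;
  vna_closed : closed (M : set wot) }.

Variable M : set (bop H).

(* M_*, as the space of the functionals x |-> \sum_n <x (xi n), eta n> on M,
   with \sum_n |xi n|^2 and \sum_n |eta n|^2 finite. *)
Definition square_summable (xi : nat -> H) : Prop :=
  cvgn (series (fun n => complex.Re `|xi n| ^+ 2)).

Definition predual : set (set_type M -> C) :=
  [set f | exists xi eta : nat -> H,
    [/\ square_summable xi, square_summable eta &
        forall x : set_type M,
          series (fun n => dot (set_val x (xi n)) (eta n) : C) n
            @[n --> \oo] --> f x]].

Definition predual_norm (f : set_type M -> C) : R :=
  sup [set complex.Re `|f x| | x in [set x | opnorm (set_val x) <= 1]].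

Definition separable_predual : Prop :=
  exists2 D : set (set_type M -> C),
    countable D /\ D `<=` predual &
    forall f, predual f -> forall e : R, 0 < e ->
      exists2 g, D g & predual_norm (f - g) < e.

Definition predual_eval (x : set_type M) : {ptws set_type predual -> C} :=
  fun f => set_val f x.

(* M with the ultraweak topology sigma(M, M_* ) *)
Definition ultraweak : Type := initial_topology predual_eval.
HB.instance Definition _ := Topological.on ultraweak.

(* the closed unit ball (M)_1, with the weak operator topology *)
Definition vna_ball_set : set wot := [set x | M x /\ opnorm x <= 1].
Definition vna_ball : Type := set_type vna_ball_set.
HB.instance Definition _ := Topological.on vna_ball.

(* (V)_1, for V included in M, as a subset of (M)_1 *)
Definition ball_of (V : set (bop H)) : set vna_ball :=
  [set x | V (set_val x)].

End VonNeumann.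
Arguments predual {R H} dot M _.
Arguments ball_of {R H} dot M V _.

(* The Vietoris topology is generated by {F | F meets U} and {F | F is included
   in U}, for U open. It is defined here on all the subsets of X, and induces the
   usual Vietoris topology on the closed ones. *)
Section Vietoris.
Variable X : topologicalType.

Definition vietoris : Type := set X.
HB.instance Definition _ := Choice.copy vietoris (set X).

Definition vietoris_subbase : set (set vietoris) :=
  [set [set F : set X | F `&` U !=set0] | U in @open X] `|`
  [set [set F : set X | F `<=` U] | U in @open X].

HB.instance Definition _ :=
  isSubBaseTopological.Build vietoris vietoris_subbase id.

End Vietoris.

Section Grassmannian.
Variables (R : realType) (H : completeNormedModType R[i]).
Variables (dot : {dot H for Num.conj}) (M : set (bop H)).

Definition uw_closed_subspaces : set (set (bop H)) :=
  [set V | [/\ V `<=` M, is_subspace V &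
               closed (set_val @^-1` V : set (ultraweak dot M))]].

Definition ball_map (V : set_type uw_closed_subspaces) :
    vietoris (vna_ball dot M) :=
  ball_of dot M (set_val V).

(* The unit balls (V)_1 being closed in (M)_1, this is the topology induced by
   the Vietoris topology on the closed subsets of (M)_1. *)
Definition grassmannian : Type := initial_topology ball_map.
HB.instance Definition _ := Topological.on grassmannian.

Definition space_of (V : grassmannian) : set (bop H) :=
  set_val (V : set_type uw_closed_subspaces).

End Grassmannian.

(* Main.v *)
From HB Require Import structures.
Require Import Defs.
From mathcomp Require Import all_boot all_order all_algebra finmap.
From mathcomp Require Import sesquilinear complex.
From mathcomp Require Import ring lra.
From mathcomp Require Import all_classical all_reals all_analysis.

Set Implicit Arguments.
Unset Strict Implicit.
Unset Printing Implicit Defensive.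

Import Order.TTheory GRing.Theory Num.Theory.
Import numFieldNormedType.Exports.

Local Open Scope classical_set_scope.
Local Open Scope ring_scope.

(**
The compact space (M)_1 carries a strictly convex distance, and nearest points
for that distance provide the selections.

A countable norm-dense subset of the predual gives a sequence of functionals,
hence of real functions h n (their real and imaginary parts), which are
continuous on (M)_1 and separate its points. After rescaling,
Phi x y = \sum_n (h n x - h n y)^2 is continuous in x, vanishes only on the
diagonal, and satisfies the parallelogram identity ([sqdist_parallelogram]),
because the h n respect midpoints. For V in the Grassmannian, (V)_1 is a
nonempty closed subset of the compact space (M)_1 and contains the midpoints of
its elements, so that every y in (M)_1 has a unique Phi-nearest point p_V(y) in
(V)_1.

For a fixed y, the map V |-> p_V(y) is continuous: the minimizer of a fixed
continuous function on a closed set depends continuously on that set in the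
Vietoris topology as long as it is unique ([argmin_continuous]). Compactness
also gives a Phi-dense sequence y_n in (M)_1, and the maps V |-> p_V(y_n) are
the selections: if x is in (V)_1 and y_n is Phi-close to x, then p_V(y_n) is at
least as close to y_n as x is, hence is Phi-close to x, and
Phi-neighbourhoods of x are small in the weak topology by compactness. This is
[dense_continuous_selections], a statement about compact spaces only.

Three facts about operators remain. The ball (M)_1 is compact in the weak
operator topology ([vna_ball_compact]): along an ultrafilter all the matrix
coefficients converge, and the limit is a sesquilinear form, which the Riesz
representation theorem ([riesz], [sesquilinear_op]) turns into an operator.
Elements of the predual are continuous on (M)_1 ([predual_continuous]), being
uniform limits there of finite sums of matrix coefficients; so (V)_1 is closed
([ball_of_closed]). A norm-dense subset of the predual separates the points of
(M)_1 ([predual_dense_separates]), since it approximates the matrix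
coefficients uniformly on the ball.
*)

(** * Minimizers and the Vietoris topology *)

Lemma vietoris_subbase_open (X : topologicalType) (A : set (vietoris X)) :
  vietoris_subbase A -> open A.
Proof.
move=> sA; exists [set A]; last by rewrite bigcup_set1.
by move=> _ ->; exact: finI_from1.
Qed.

Section Selection.
Variables (R : realType) (X : topologicalType) (cX : compact [set: X]).

Lemma continuous_bounded (f : X -> R) : continuous f ->
  exists2 b, 0 < b & forall x, `|f x| <= b.
Proof.
move=> cf; have : compact (f @` setT).
  by apply: continuous_compact => //; exact: continuous_subspaceT.
move=> /compact_bounded/ex_strict_bound_gt0[b b0 fb]; exists b => // x.
by apply/ltW/fb; exists x.
Qed.

(** Infima are attained on closed sets, so a strict pointwise bound leaves a
gap. The empty set is allowed. *)
Lemma compact_min_gt (f : X -> R) (A : set X) (a : R) :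
  closed A -> continuous f -> (forall x, A x -> a < f x) ->
  exists2 r, a < r & forall x, A x -> r < f x.
Proof.
move=> clA cf afA; have [A0|/nonemptyPn ->] := pselect (A !=set0); last first.
  by exists (a + 1); rewrite ?ltrDl.
have cA : compact A := subclosed_compact clA cX (@subsetT _ _).
have [c /set_mem Ac fc] := compact_EVT_min A0 cA (continuous_subspaceT cf).
exists ((a + f c) / 2); first by rewrite midf_lt// afA.
by move=> x Ax; rewrite (lt_le_trans _ (fc x (mem_set Ax)))// midf_lt// afA.
Qed.

(** If U is a neighbourhood of the minimizer at t0, then f exceeds some r > min
f on the part of K t0 outside U. For t near t0 the set K t lies in the union of
U and {f > r}, and it has a point where f < r; its minimizer can then only be
in U. *)
Lemma argmin_continuous (T : topologicalType) (K : T -> vietoris X)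
    (f : X -> R) (p : T -> X) :
  continuous K -> (forall t, closed (K t : set X)) -> continuous f ->
  (forall t, (K t : set X) (p t)) ->
  (forall t x, (K t : set X) x -> f x <= f (p t) -> x = p t) ->
  continuous p.
Proof.
move=> cK clK cf Kp minp t0 U0; rewrite nbhsE => -[U [oU Up] UU0].
have [|x [Kx /= nUx]|r fr Kr] :=
    @compact_min_gt f ((K t0 : set X) `&` ~` U) (f (p t0)) _ cf.
- by apply: closedI => //; exact: open_closedC.
- by rewrite ltNge; apply/negP => /(minp _ _ Kx) xp; apply: nUx; rewrite xp.
have oW1 : open (U `|` f @^-1` [set y | r < y]).
  by apply: openU => //; apply: open_comp => // *; exact: cf.
have oW2 : open (U `&` f @^-1` [set y | y < r]).
  by apply: openI => //; apply: open_comp => // *; exact: cf.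
have n1 : nbhs (K t0) [set F : set X | F `<=` U `|` f @^-1` [set y | r < y]].
  apply: open_nbhs_nbhs; split.
    by apply: vietoris_subbase_open; right; eexists; first exact: oW1.
  by move=> x Kx; have [Ux|nUx] := pselect (U x); [left|right; exact: Kr].
have n2 : nbhs (K t0)
    [set F : set X | F `&` (U `&` f @^-1` [set y | y < r]) !=set0].
  apply: open_nbhs_nbhs; split.
    by apply: vietoris_subbase_open; left; eexists; first exact: oW2.
  by exists (p t0).
have k1 : nbhs t0 _ := cK t0 _ n1.
have k2 : nbhs t0 _ := cK t0 _ n2.
suff : nbhs t0 (p @^-1` U0) by [].
apply: filterS2 k1 k2 => t /= K1 [z [Kz [_ fz]]]; apply: UU0.
have [//|/= fp] := K1 _ (Kp t).
have := minp t z Kz (ltW (lt_trans fz fp)) => zp.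
by move: (lt_trans fz fp); rewrite zp ltxx.
Qed.

(** * Uniformly convergent series *)

(** The bound is uniform in u: it only involves the dominating series. *)
Lemma series_tail_le (u a : R ^nat) (l : R) :
  (forall n, `|u n| <= a n) -> cvgn (series a) -> series u n @[n --> \oo] --> l ->
  forall n, `|l - series u n| <= limn (series a) - series a n.
Proof.
move=> ua ca ul n; apply/ler_addgt0Pr => e e0.
have /cvgrPdist_lt/(_ _ e0)[N _ uN] := ul.
pose m := maxn N n.
have := uN m (leq_maxl _ _) => /= um.
rewrite -(subrKA (series u m)) (le_trans (ler_normD _ _))//.
rewrite [leRHS]addrC lerD ?(ltW um)//.
rewrite sub_series_geq ?leq_maxr// (le_trans (ler_norm_sum _ _ _))//.
apply: (@le_trans _ _ (series a m - series a n)).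
  by rewrite sub_series_geq ?leq_maxr//; apply: ler_sum => i _.
rewrite lerD2r; apply: nondecreasing_cvgn_le => //.
by apply: nondecreasing_series => i _ _; exact: le_trans (ua i).
Qed.

(** The Weierstrass M-test. *)
Lemma series_continuous (u : nat -> X -> R) (a : R ^nat) (f : X -> R) :
  (forall n, continuous (u n)) -> (forall n x, `|u n x| <= a n) ->
  cvgn (series a) -> (forall x, series (u ^~ x) n @[n --> \oo] --> f x) ->
  continuous f.
Proof.
move=> cu ua ca uf x; apply/cvgrPdist_lt => e e0.
have e30 : 0 < e / 3 by rewrite divr_gt0.
have /cvgrPdist_lt/(_ _ e30)[N _ /(_ _ (leqnn N)) /= aN] := ca.
have {aN} fN y : `|f y - series (u ^~ y) N| < e / 3.
  apply: le_lt_trans aN.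
  by rewrite (le_trans (series_tail_le (ua^~ y) ca (uf y) N))// ler_norm.
have cs : (fun y => series (u ^~ y) N) @ x --> series (u ^~ x) N.
  by rewrite /series/=; apply: cvg_big => [|i _];
    [exact: add_continuous|exact: cu].
have /cvgrPdist_lt/(_ _ e30) := cs.
apply: filterS => y /= sxy.
have -> : f x - f y = (f x - series (u^~ x) N) +
  (series (u^~ x) N - series (u^~ y) N) - (f y - series (u^~ y) N) by ring.
have := ler_normB (f x - series (u^~ x) N +
  (series (u^~ x) N - series (u^~ y) N)) (f y - series (u^~ y) N).
have := ler_normD (f x - series (u^~ x) N)
  (series (u^~ x) N - series (u^~ y) N).
have := fN x; have := fN y; lra.
Qed.

(** * A Hilbertian squared distance *)

Section SquaredDistance.
Variable k : nat -> X -> R.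
Hypothesis ck : forall n, continuous (k n).
Hypothesis kb : forall n x y, `|k n x - k n y| <= 2^-1 ^+ n.

(** The squared distance between the images of x and y in the sequence space l^2
under x |-> (k n x)_n. *)
Definition sqdist (x y : X) : R :=
  limn (series (fun n => (k n x - k n y) ^+ 2)).

Let half_cvg : cvgn (series (fun n => 2^-1 ^+ n : R)).
Proof.
have := @is_cvg_geometric_series R 1 2^-1; rewrite /geometric/=.
under eq_fun do rewrite mul1r.
by apply; rewrite ger0_norm ?invr_ge0// invf_lt1// ltr1n.
Qed.

Let sqr_le n x y : (k n x - k n y) ^+ 2 <= 2^-1 ^+ n.
Proof.
rewrite -real_normK ?num_real// (le_trans _ (kb n x y))// expr2 ler_piMr//.
by rewrite (le_trans (kb n x y))// exprn_ile1 ?invr_ge0// invf_le1// ler1n.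
Qed.

Lemma sqdist_cvg x y :
  series (fun n => (k n x - k n y) ^+ 2) n @[n --> \oo] --> sqdist x y.
Proof.
apply: (@series_le_cvg _ _ (fun n => 2^-1 ^+ n)) => // n.
exact: sqr_ge0.
Qed.

Lemma sqdist_continuous y : continuous (sqdist ^~ y).
Proof.
apply: (@series_continuous (fun n x => (k n x - k n y) ^+ 2)
    (fun n => 2^-1 ^+ n)) => [n x|n x||x].
- have cd : (k n z - k n y) @[z --> x] --> k n x - k n y.
    by apply: cvgB; [exact: ck|exact: cvg_cst].
  exact: (cvg_comp _ _ cd (@exprn_continuous R 2 _)).
- by rewrite ger0_norm ?sqr_ge0.
- exact: half_cvg.
- exact: sqdist_cvg.
Qed.

Lemma sqdist_ge n x y : (k n x - k n y) ^+ 2 <= sqdist x y.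
Proof.
have nd : nondecreasing_seq (series (fun n => (k n x - k n y) ^+ 2)).
  by apply: nondecreasing_series => i _ _; exact: sqr_ge0.
apply: le_trans (nondecreasing_cvgn_le nd _ n.+1); last first.
  exact: cvgP (@sqdist_cvg x y).
rewrite seriesSr lerDr; apply: sumr_ge0 => i _; exact: sqr_ge0.
Qed.

Lemma sqdist_le0 x y : sqdist x y <= 0 -> forall n, k n x = k n y.
Proof.
move=> d0 n; apply/eqP; rewrite -subr_eq0 -sqrf_eq0 eq_le sqr_ge0 andbT.
exact: le_trans (sqdist_ge n x y) d0.
Qed.

Lemma sqdistxx x : sqdist x x = 0.
Proof.
apply: cvg_lim => //; rewrite (_ : series _ = cst 0); first exact: cvg_cst.
by apply/funext => n; rewrite /series/= big1// => i _; rewrite subrr expr0n.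
Qed.

Lemma sqdistC x y : sqdist x y = sqdist y x.
Proof.
rewrite /sqdist; congr (limn (series _)).
by apply/funext => n; rewrite -opprB sqrrN.
Qed.

(** The parallelogram identity: a midpoint of two minimizers of the distance to
z would be strictly closer to z, unless the two are at distance 0. *)
Lemma sqdist_parallelogram m x y z :
    (forall n, k n m = (k n x + k n y) / 2) ->
  sqdist m z + sqdist x y / 4 = (sqdist x z + sqdist y z) / 2.
Proof.
move=> km; pose S a b := series (fun n => (k n a - k n b) ^+ 2).
have lhs : S m z n + S x y n / 4 @[n --> \oo] --> sqdist m z + sqdist x y / 4.
  by apply: cvgD; [|apply: cvgMr_tmp]; exact: sqdist_cvg.
have rhs : (S x z n + S y z n) / 2 @[n --> \oo] -->
    (sqdist x z + sqdist y z) / 2.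
  by apply: cvgMr_tmp; apply: cvgD; exact: sqdist_cvg.
rewrite -(cvg_lim (@Rhausdorff R) lhs) -(cvg_lim (@Rhausdorff R) rhs).
congr (lim (_ @ \oo)); apply/funext => n.
rewrite /S /series/= !mulr_suml -!big_split/= mulr_suml; apply: eq_bigr => i _.
by rewrite km; field.
Qed.

(** The triangle inequality for squares, from (a + b)^2 <= 2 a^2 + 2 b^2. *)
Lemma sqdist_triangle x y z : sqdist x z <= 2 * (sqdist x y + sqdist y z).
Proof.
pose S a b := series (fun n => (k n a - k n b) ^+ 2).
have rhs : 2 * (S x y n + S y z n) @[n --> \oo] -->
    2 * (sqdist x y + sqdist y z).
  by apply: cvgMl_tmp; apply: cvgD; exact: sqdist_cvg.
apply: (ler_cvg_to (@sqdist_cvg x z) rhs); apply: nearW => n /=.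
rewrite /S /series/= -!big_split/= mulr_sumr; apply: ler_sum => i _.
have := sqr_ge0 (k i x - k i y - (k i y - k i z)).
by nra.
Qed.

Lemma sqdist_open y e : open [set x | sqdist x y < e].
Proof.
by apply: (open_comp (f := sqdist ^~ y) (D := [set r | r < e])) => // x _;
  exact: sqdist_continuous.
Qed.

Lemma sqdist_finite_net (x0 : X) e : 0 < e ->
  exists s : seq X, forall x, exists2 y, y \in s & sqdist x y < e.
Proof.
(* The covering form of compactness is about pointed spaces: x0 is the point. *)
move=> e0; pose Xp := HB.pack_for ptopologicalType X (isPointed.Build X x0).
have : @compact Xp setT := cX; rewrite compact_cover.
move=> /(_ X setT (fun y => [set x | sqdist x y < e])).
case=> [y _|x _|s _ sX]; first exact: sqdist_open.
- by exists x => //=; rewrite sqdistxx.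
- by exists (enum_fset s) => x; have [y ys xy] := sX x I; exists y.
Qed.

(** The union of finite 2^-i-nets; the pairs (i, j) index the j-th point of the
i-th net. *)
Lemma sqdist_dense_seq (x0 : X) : exists y : nat -> X,
  forall x e, 0 < e -> exists n, sqdist x (y n) < e.
Proof.
have net n : exists s : seq X,
    forall x, exists2 y, y \in s & sqdist x y < 2^-1 ^+ n.
  by apply: (sqdist_finite_net x0); rewrite exprn_gt0// invr_gt0.
have [s sP] := choice net.
exists (fun n => if @choice.unpickle (nat * nat)%type n is Some (i, j)
  then nth x0 (s i) j else x0).
move=> x e e0; have [i ie] : exists i, 2^-1 ^+ i < e.
  have [i _ /(_ i (leqnn i))] := near_infty_natSinv_expn_lt (PosNum e0).
  by rewrite /= div1r => ie; exists i; rewrite exprVn.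
have [y ys xy] := sP i x; exists (choice.pickle (i, index y (s i))).
by rewrite /= choice.pickleK nth_index//; exact: lt_trans ie.
Qed.

(** When the functions k n separate points, the distance to x is bounded away
from 0 on the compact complement of U: the distance defines the topology of X.
*)
Lemma sqdist_nbhs (x : X) (U : set X) :
  (forall x y, (forall n, k n x = k n y) -> x = y) -> open U -> U x ->
  exists2 e, 0 < e & forall y, sqdist y x < e -> U y.
Proof.
move=> kinj oU Ux; have [||e e0 eU] :=
    @compact_min_gt (sqdist ^~ x) (~` U) 0 _ (@sqdist_continuous x).
- exact: open_closedC.
- move=> y; apply: contra_notP => /negP; rewrite -leNgt.
  by move=> /sqdist_le0/kinj ->.
- exists e => // y ye; apply: contrapT => /eU.
  by rewrite ltNge (ltW ye).
Qed.

End SquaredDistance.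

(** * Selections from midpoint-convex sets *)

Lemma continuous_rescale (h : nat -> X -> R) : (forall n, continuous (h n)) ->
  exists2 c : nat -> R, (forall n, c n != 0) &
    forall n x y, `|c n * h n x - c n * h n y| <= 2^-1 ^+ n.
Proof.
move=> ch; suff: forall n, exists c : R, c != 0 /\
    forall x y, `|c * h n x - c * h n y| <= 2^-1 ^+ n.
  by move=> /choice[c /all_and2[c0 cP]]; exists c.
move=> n.
have [b b0 hb] := continuous_bounded (ch n).
exists (2^-1 ^+ n / (2 * b)); split.
  by rewrite mulf_neq0 ?invr_neq0 ?expf_neq0 ?mulf_neq0 ?invr_neq0 ?gt_eqF.
move=> x y; rewrite -mulrBr normrM ger0_norm; last first.
  by rewrite divr_ge0// ?exprn_ge0 ?invr_ge0// mulr_ge0// ltW.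
rewrite -[_ / _ * _]mulrA ler_piMr ?exprn_ge0 ?invr_ge0//.
rewrite mulrC ler_pdivrMr ?mulr_gt0// mul1r.
by rewrite (le_trans (ler_normB _ _))// mulr2n mulrDl !mul1r lerD.
Qed.

(** The n-th selection maps t to the point of K t nearest to y n, for a dense
sequence y. The family h plays the role of a linear embedding of X into a
sequence space, for which each K t is convex. *)
Theorem dense_continuous_selections (T : topologicalType) (K : T -> vietoris X)
    (h : nat -> X -> R) (x0 : X) :
  continuous K -> (forall t, closed (K t : set X)) ->
  (forall t, (K t : set X) !=set0) ->
  (forall n, continuous (h n)) ->
  (forall x y, (forall n, h n x = h n y) -> x = y) ->
  (forall t x y, (K t : set X) x -> (K t : set X) y ->
    exists2 m, (K t : set X) m & forall n, h n m = (h n x + h n y) / 2) ->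
  exists p : nat -> T -> X, (forall n, continuous (p n)) /\
    forall t, (forall n, (K t : set X) (p n t)) /\
      (K t : set X) `<=` closure (range (fun n => p n t)).
Proof.
move=> cK clK K0 ch hinj Kmid; have [c c0 cP] := continuous_rescale ch.
pose k n x := c n * h n x.
have ck n : continuous (k n) by move=> x; apply: cvgMl_tmp; exact: ch.
have kinj x y : (forall n, k n x = k n y) -> x = y.
  by move=> kxy; apply: hinj => n; apply: (mulfI (c0 n)); exact: kxy.
have kmid t x y : (K t : set X) x -> (K t : set X) y ->
    exists2 m, (K t : set X) m & forall n, k n m = (k n x + k n y) / 2.
  move=> Kx Ky; have [m Km hm] := Kmid t x y Kx Ky; exists m => // n.
  by rewrite /k hm -mulrDr mulrA.
have [y ydense] := sqdist_dense_seq ck cP x0.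
have pex n t : exists x, (K t : set X) x /\
    forall z, (K t : set X) z -> sqdist k x (y n) <= sqdist k z (y n).
  have cKt : compact (K t : set X) :=
    subclosed_compact (clK t) cX (@subsetT _ _).
  have [x /set_mem Kx xmin] := compact_EVT_min (K0 t) cKt
    (continuous_subspaceT (sqdist_continuous ck cP (y := y n))).
  by exists x; split=> // z /mem_set; exact: xmin.
have [p /all_and2] := choice (fun nt : nat * T => pex nt.1 nt.2).
case=> Kp pmin; exists (fun n t => p (n, t)); split=> [n|t].
  apply: (argmin_continuous cK clK (sqdist_continuous ck cP (y := y n))) => [t|t x].
    exact: Kp (n, t).
  (* Two minimizers x and p have a midpoint m in K t, no closer to y n than p:
     the parallelogram identity forces x and p to be at distance 0. *)
  move=> Kx xp; have [m Km kxp] := kmid t x _ Kx (Kp (n, t)).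
  apply: kinj; apply: (sqdist_le0 cP).
  have := sqdist_parallelogram cP (y n) kxp.
  by have := pmin (n, t) m Km; rewrite /=; lra.
split=> [n|x Kx U]; first exact: Kp (n, t).
rewrite nbhsE => -[V [oV Vx] VU].
have [e e0 eV] := sqdist_nbhs ck cP kinj oV Vx.
(* The distance from p to x is at most 2 (d + d), with d the distance from x to
   y n, which bounds the distance from p to y n by minimality. *)
have [n xn] : exists n, sqdist k x (y n) < e / 4.
  by apply: ydense; rewrite divr_gt0.
exists (p (n, t)); split; first by exists n.
apply: VU; apply: eV.
have := sqdist_triangle cP (p (n, t)) (y n) x.
by have := pmin (n, t) x Kx; rewrite /= (sqdistC _ (y n)); lra.
Qed.
End Selection.

(** * Real and imaginary parts *)

Local Notation Re := complex.Re.
Local Notation Im := complex.Im.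

Section ComplexTopology.
Variable R : realType.
Local Notation C := (R[i]^o).

Lemma ReD (z w : R[i]) : Re (z + w) = Re z + Re w.
Proof. by case: z; case: w. Qed.

Lemma ImD (z w : R[i]) : Im (z + w) = Im z + Im w.
Proof. by case: z; case: w. Qed.

Lemma ReB (z w : R[i]) : Re (z - w) = Re z - Re w.
Proof. by case: z; case: w. Qed.

Lemma ImB (z w : R[i]) : Im (z - w) = Im z - Im w.
Proof. by case: z; case: w. Qed.

Lemma ReN (z : R[i]) : Re (- z) = - Re z.
Proof. by case: z. Qed.

Lemma half_realE : 2^-1 = (2^-1 : R)%:C%C :> R[i].
Proof. by rewrite fmorphV rmorph_nat. Qed.

Lemma Re_half (z : R[i]) : Re (2^-1 * z) = Re z / 2.
Proof. by rewrite half_realE; case: z => a b /=; rewrite mul0r subr0 mulrC. Qed.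

Lemma Im_half (z : R[i]) : Im (2^-1 * z) = Im z / 2.
Proof. by rewrite half_realE; case: z => a b /=; rewrite mul0r addr0 mulrC. Qed.

Lemma normc_ReE (V : normedZmodType R[i]) (v : V) : `|v| = (Re `|v|)%:C%C.
Proof. by rewrite RRe_real// ger0_real. Qed.

Lemma normc_lt (V : normedZmodType R[i]) (v : V) (e : R) :
  (`|v| < e%:C%C) = (Re `|v| < e).
Proof. by rewrite normc_ReE ltcR. Qed.

Lemma normc_le (V : normedZmodType R[i]) (v : V) (e : R) :
  (`|v| <= e%:C%C) = (Re `|v| <= e).
Proof. by rewrite normc_ReE lecR. Qed.

Lemma Re_norm_ge0 (V : normedZmodType R[i]) (v : V) : 0 <= Re `|v|.
Proof. by rewrite -lecR -normc_ReE; exact: normr_ge0. Qed.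

Lemma Re_le_norm (z : R[i]) : `|Re z| <= Re `|z|.
Proof. by rewrite -lecR -normc_ReE normc_ge_Re. Qed.

Lemma Im_le_norm (z : R[i]) : `|Im z| <= Re `|z|.
Proof.
rewrite -normrN -ReiNIm (le_trans (Re_le_norm _))// normrM.
by rewrite (_ : `|'i%C| = 1 :> R[i]) ?mulr1//
  normc_def/= expr0n add0r expr1n sqrtr1.
Qed.

Lemma norm_le_ReIm (z : R[i]) : Re `|z| <= `|Re z| + `|Im z|.
Proof.
rewrite normc_def/= -[leRHS]ger0_norm ?addr_ge0// -sqrtr_sqr.
rewrite ler_wsqrtr// sqrrD !real_normK ?num_real// lerD2r lerDl.
by rewrite mulrn_wge0// mulr_ge0.
Qed.

Lemma posc_ex (e : R[i]) : 0 < e -> exists2 r : R, 0 < r & e = r%:C%C.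
Proof.
move=> e0; exists (Re e); last by rewrite RRe_real// gtr0_real.
by rewrite -ltcR RRe_real// gtr0_real.
Qed.

Lemma Re_continuous : continuous (@Re R : C -> R).
Proof.
move=> z; apply/(@cvgrPdist_lt _ _ _ (nbhs z)) => e e0.
have e0' : 0 < e%:C%C :> R[i] by rewrite ltcR.
have := nbhsx_ballx (z : C) _ e0'; apply: filterS => w.
rewrite -ball_normE /= normc_lt; apply: le_lt_trans.
by rewrite -ReB Re_le_norm.
Qed.

Lemma Im_continuous : continuous (@Im R : C -> R).
Proof.
move=> z; apply/(@cvgrPdist_lt _ _ _ (nbhs z)) => e e0.
have e0' : 0 < e%:C%C :> R[i] by rewrite ltcR.
have := nbhsx_ballx (z : C) _ e0'; apply: filterS => w.
rewrite -ball_normE /= normc_lt; apply: le_lt_trans.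
by rewrite -ImB Im_le_norm.
Qed.

Lemma complex_cvg (T : Type) (F : set_system T) (FF : Filter F)
    (f : T -> C) (l : C) :
  (Re (f x)) @[x --> F] --> Re l -> (Im (f x)) @[x --> F] --> Im l ->
  f @ F --> l.
Proof.
move=> fR fI; apply/cvgrPdist_lt => _ /posc_ex[e e0 ->].
have e20 : 0 < e / 2 by rewrite divr_gt0.
move: fR fI => /cvgrPdist_lt/(_ _ e20) fR /cvgrPdist_lt/(_ _ e20) fI.
apply: filterS2 fR fI => x fR fI; rewrite normc_lt.
rewrite (le_lt_trans (norm_le_ReIm _))// ReB ImB.
by rewrite [ltRHS]splitr ltrD.
Qed.

End ComplexTopology.

(** * Hilbert spaces as real inner product spaces *)

Section Hilbert.
Variables (R : realType) (H : completeNormedModType R[i]).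
Variable dot : {dot H for Num.conj}.
Hypothesis hilbertH : norm_of_dot dot.

(** H is handled as a real inner product space: minimization and estimates take
place in R, and the imaginary part of the inner product is recovered by
multiplying one vector by -i ([Im_dotE]). *)
Definition rdot (u v : H) : R := Re (dot u v).

Lemma dotC u v : dot u v = Num.conj (dot v u).
Proof. by rewrite (hermC dot u v) expr0 mul1r. Qed.

Lemma dotZl a u v : dot (a *: u) v = a * dot u v.
Proof. exact: linearZl_LR. Qed.

Lemma dotZr a u v : dot u (a *: v) = Num.conj a * dot u v.
Proof. exact: linearZr_LR. Qed.

Lemma dotDl u v w : dot (u + v) w = dot u w + dot v w.
Proof. exact: linearDl. Qed.

Lemma dotBl u v w : dot (u - v) w = dot u w - dot v w.
Proof. exact: linearBl. Qed.

Lemma dotDr u v w : dot w (u + v) = dot w u + dot w v.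
Proof. exact: linearDr. Qed.

Lemma rdotC u v : rdot u v = rdot v u.
Proof. by rewrite /rdot dotC; case: (dot v u). Qed.

Lemma rdotDl u v w : rdot (u + v) w = rdot u w + rdot v w.
Proof. by rewrite /rdot dotDl ReD. Qed.

Lemma rdotZl (t : R) u v : rdot (t%:C%C *: u) v = t * rdot u v.
Proof.
by rewrite /rdot dotZl/=; case: (dot u v) => a b /=; rewrite mul0r subr0.
Qed.

Lemma rdotDr u v w : rdot w (u + v) = rdot w u + rdot w v.
Proof. by rewrite rdotC rdotDl !(rdotC w). Qed.

Lemma rdotZr (t : R) u v : rdot u (t%:C%C *: v) = t * rdot u v.
Proof. by rewrite rdotC rdotZl rdotC. Qed.

Lemma rdotNl u v : rdot (- u) v = - rdot u v.
Proof. by rewrite /rdot linearNl ReN. Qed.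

Lemma rdotNr u v : rdot u (- v) = - rdot u v.
Proof. by rewrite rdotC rdotNl rdotC. Qed.

Lemma rdot0r u : rdot u 0 = 0.
Proof. by rewrite /rdot linear0r. Qed.

Lemma rdotE u : rdot u u = Re `|u| ^+ 2.
Proof. by rewrite /rdot -hilbertH normc_ReE expr2 /= mulr0 subr0. Qed.

Lemma rdot_ge0 u : 0 <= rdot u u.
Proof. by rewrite rdotE sqr_ge0. Qed.

(** This additive form of the Cauchy-Schwarz inequality sums over square-
summable sequences at once, and it passes to limits and to real and imaginary
parts. *)
Lemma rdot_amgm u v : rdot u v <= (rdot u u + rdot v v) / 2.
Proof.
have := rdot_ge0 (u - v).
rewrite !(rdotDl, rdotDr, rdotNl, rdotNr) (rdotC v u); lra.
Qed.

Lemma rdot_amgm_norm u v : `|rdot u v| <= (rdot u u + rdot v v) / 2.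
Proof.
rewrite ler_norml rdot_amgm andbT lerNl.
by rewrite -rdotNl (le_trans (rdot_amgm _ _))// rdotNl rdotNr opprK.
Qed.

Lemma Im_dotE u v : Im (dot u v) = rdot ((- 'i%C) *: u) v.
Proof.
rewrite /rdot dotZl/=; case: (dot u v) => a b /=.
by rewrite oppr0 mul0r sub0r mulN1r opprK.
Qed.

Lemma rdot_iZ u v : rdot ((- 'i%C) *: u) ((- 'i%C) *: v) = rdot u v.
Proof.
rewrite /rdot dotZl dotZr mulrA (_ : - 'i%C * Num.conj (- 'i%C) = 1) ?mul1r//.
apply/eqP; rewrite eq_complex/= oppr0 !mul0r opprK mulr1 sub0r opprK mulr0.
by rewrite addr0 !eqxx.
Qed.

Lemma dot_inj u w : (forall v, dot u v = dot w v) -> u = w.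
Proof.
move=> uw; apply/eqP; rewrite -subr_eq0 -normr_eq0 -sqrf_eq0 hilbertH.
by rewrite dotBl uw subrr.
Qed.

(** Expand the square of the norm of |v|^2 u - (u|v) v. *)
Lemma rdot_CauchySchwarz u v : rdot u v ^+ 2 <= rdot u u * rdot v v.
Proof.
have [v0|v_neq0] := eqVneq (rdot v v) 0.
  suff -> : v = 0 by rewrite !rdot0r expr0n mulr0.
  by apply/eqP; rewrite -normr_eq0 -sqrf_eq0 normc_ReE -rmorphXn -rdotE v0.
have v0 : 0 < rdot v v by rewrite lt_def v_neq0 rdot_ge0.
have := rdot_ge0 ((rdot v v)%:C%C *: u - (rdot u v)%:C%C *: v).
rewrite !(rdotDl, rdotDr, rdotNl, rdotNr, rdotZl, rdotZr) (rdotC v u) => h.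
rewrite -(ler_pM2l v0); move: h; nra.
Qed.

Lemma rdot_continuous v : continuous (rdot v).
Proof.
move=> x; apply/(@cvgrPdist_le _ _ _ (nbhs x)) => e e0.
have d0 : 0 < (e / (1 + Re `|v|))%:C%C :> R[i].
  by rewrite ltcR divr_gt0// ltr_pwDl// Re_norm_ge0.
have := nbhsx_ballx x _ d0; apply: filterS => y.
rewrite -ball_normE /= normc_lt => /ltW xy.
rewrite -rdotNr -rdotDr -ler_sqr ?nnegrE ?(ltW e0)//.
rewrite real_normK ?num_real// (le_trans (rdot_CauchySchwarz _ _))//.
rewrite !rdotE -exprMn ler_sqr ?nnegrE ?mulr_ge0 ?Re_norm_ge0 ?(ltW e0)//.
rewrite (le_trans (ler_wpM2l (Re_norm_ge0 _) xy))//.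
rewrite mulrCA ler_piMr ?(ltW e0)// ler_pdivrMr ?ltr_pwDl ?Re_norm_ge0//.
by rewrite mul1r lerDr.
Qed.

(** Riesz representation, by minimizing J v = |v|^2 - 2 phi v, which the last
hypothesis bounds below by - c. By the parallelogram identity minimizing
sequences are Cauchy; their limit w minimizes J, and the vanishing of the first
variation of J at w reads phi = (w|-). *)
Lemma riesz (phi : H -> R) (c : R) :
  (forall u v, phi (u + v) = phi u + phi v) ->
  (forall (t : R) u, phi (t%:C%C *: u) = t * phi u) ->
  (forall v, phi v <= (c + rdot v v) / 2) ->
  exists w, forall v, phi v = rdot w v.
Proof.
move=> phiD phiZ phic; pose J v := rdot v v - 2 * phi v.
have lbJ : has_lbound (range J).
  by exists (- c) => _ [v _ <-]; have := phic v; rewrite /J; lra.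
have infJ : has_inf (range J) by split=> //; exists (J 0); exists 0.
pose m := inf (range J).
have mJ v : m <= J v by apply: ge_inf => //; exists v.
pose d n : R := n.+1%:R^-1.
have /choice[a aJ] : forall n, exists v, J v < m + d n.
  move=> n; have dn0 : 0 < d n by rewrite invr_gt0.
  by have [_ [v _ <-] Jv] := inf_adherent dn0 infJ; exists v.
have d_cvg : d @ \oo --> 0 by exact: cvg_harmonic.
have a_dist k n : rdot (a k - a n) (a k - a n) <= 2 * (d k + d n).
  have := mJ (2^-1%:C%C *: (a k + a n)); have := aJ k; have := aJ n.
  rewrite /J !(rdotDl, rdotDr, rdotNl, rdotNr, rdotZl, rdotZr, phiD, phiZ).
  by rewrite (rdotC (a n) (a k)); lra.
have /cauchy_cvgP/cvg_ex[/= w aw] : cauchy (a @ \oo).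
  apply/cauchy_ballP => _ /posc_ex[e e0 ->].
  have e20 : 0 < e ^+ 2 / 4 by rewrite divr_gt0// exprn_gt0.
  have /cvgrPdist_lt/(_ _ e20) := d_cvg.
  rewrite near_map2 => dn; near=> k n.
  rewrite -ball_normE /= normc_lt -ltr_sqr ?nnegrE ?Re_norm_ge0 ?(ltW e0)//.
  rewrite -rdotE (le_lt_trans (a_dist _ _))//.
  have dk : `|0 - d k| < e ^+ 2 / 4 by near: k.
  have dn' : `|0 - d n| < e ^+ 2 / 4 by near: n.
  by move: dk dn'; rewrite !sub0r !normrN !ger0_norm ?invr_ge0//; lra.
exists w => v; pose D := rdot v w - phi v.
(* The limit of J (a n + t v) - J (a n) >= - d n, where d n tends to 0. *)
have quad t : 0 <= t ^+ 2 * rdot v v + 2 * t * D.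
  have lim_t : t ^+ 2 * rdot v v + 2 * t * (rdot v (a n) - phi v) + d n
      @[n --> \oo] --> t ^+ 2 * rdot v v + 2 * t * D + 0.
    apply: cvgD => //; apply: cvgD; first exact: cvg_cst.
    apply: cvgMl_tmp; apply: cvgB; last exact: cvg_cst.
    exact: (cvg_comp _ _ aw (@rdot_continuous v w)).
  rewrite -[leRHS]addr0 -(cvg_lim (@Rhausdorff R) lim_t).
  apply: limr_ge; first exact: cvgP lim_t.
  apply: nearW => n; have := mJ (a n + t%:C%C *: v); have := aJ n.
  rewrite /J !(rdotDl, rdotDr, rdotZl, rdotZr, phiD, phiZ) (rdotC (a n) v).
  by nra.
suff D0 : D = 0 by rewrite rdotC; apply/esym/eqP; rewrite -subr_eq0 -/D D0.
(* The quadratic polynomial in quad is nonnegative; it is negative at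
   t = - D / (1 + |v|^2) unless D = 0. *)
have v1 : 0 < 1 + rdot v v by rewrite ltr_pwDl// rdot_ge0.
have := quad (- (D / (1 + rdot v v))).
set s := 1 + rdot v v in v1 *; have -> : rdot v v = s - 1 by rewrite /s; ring.
move=> h; have : 0 <= - (D / s) ^+ 2 * (s + 1).
  apply: le_trans h _; rewrite le_eqVlt; apply/orP; left; apply/eqP.
  by field; rewrite gt_eqF.
have s0 : s + 1 > 0 by rewrite addr_gt0.
rewrite pmulr_lge0// oppr_ge0 => h'.
have /eqP : (D / s) ^+ 2 == 0 by rewrite eq_le h' sqr_ge0.
by move/eqP; rewrite sqrf_eq0 mulf_eq0 invr_eq0 (gt_eqF v1) orbF => /eqP.
Unshelve. all: by end_near. Qed.

End Hilbert.
(** * Bounded operators and sesquilinear forms *)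

Section Operators.
Variables (R : realType) (H : completeNormedModType R[i]).
Variable dot : {dot H for Num.conj}.
Hypothesis hilbertH : norm_of_dot dot.
Local Notation rdot := (rdot dot).

Lemma bop_linear (T : bop H) a u v : T (a *: u + v) = a *: T u + T v.
Proof. by have /set_mem[lT _] := bopP T; exact: lT. Qed.

Lemma bopZ (T : bop H) a u : T (a *: u) = a *: T u.
Proof.
have T0 : T 0 = 0.
  by have := bop_linear T (-1) 0 0; rewrite !scaleN1r oppr0 addr0 addNr.
by have := bop_linear T a u 0; rewrite T0 !addr0.
Qed.

Lemma bop_bounded (T : bop H) :
  exists2 r : R, 0 < r & forall u, Re `|T u| <= r * Re `|u|.
Proof.
have /set_mem[lT cT] := bopP T.
pose L : {linear H -> H} :=
  HB.pack (T : H -> H) (@GRing.isLinear.Build _ _ _ _ (T : H -> H) lT).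
have /linear_bounded_continuous/linear_boundedP : continuous L := cT.
move=> /pinfty_ex_gt0[_ /posc_ex[r r0 ->] rT]; exists r => // u.
by have := rT u; rewrite (normc_ReE u) -rmorphM normc_le.
Qed.

Lemma opnorm_le1P (T : bop H) :
  opnorm T <= 1 <-> forall u, Re `|T u| <= Re `|u|.
Proof.
pose A := [set Re `|T u| | u in [set u : H | `|u| <= 1]].
have A0 : A !=set0 by exists (Re `|T 0|); exists 0 => //=; rewrite normr0.
split=> [T1 u|T1]; last first.
  apply: ge_sup => // _ [u /= u1 <-].
  by rewrite (le_trans (T1 u))// -normc_le.
have [u0|u_neq0] := eqVneq u 0.
  by have [r _ /(_ u)] := bop_bounded T; rewrite u0 !normr0 mulr0.
have supA : has_sup A.
  split=> //; have [r r0 rT] := bop_bounded T; exists r => _ [v /= v1 <-].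
  by rewrite (le_trans (rT v))// ler_piMr ?(ltW r0)// -normc_le.
have : Re `|T (`|u|^-1 *: u)| <= 1.
  apply: le_trans T1; apply: ub_le_sup; first by case: supA.
  exists (`|u|^-1 *: u) => //=.
  rewrite normrZ normfV normr_id mulVf//.
  by rewrite normr_eq0.
rewrite bopZ -normc_le normrZ normfV normr_id.
by rewrite ler_pdivrMl ?normr_gt0// mulr1 [leRHS]normc_ReE normc_le.
Qed.

(** Riesz representation applied to v |-> Re (B u v) gives T u; taking the
vector i v in the resulting identity recovers the imaginary part of B u v. The
bound on B, read at v = T u, is the contractivity of T. *)
Lemma sesquilinear_op (B : H -> H -> R[i]) :
  (forall a u u' v, B (a *: u + u') v = a * B u v + B u' v) ->
  (forall a u v v', B u (a *: v + v') = Num.conj a * B u v + B u v') ->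
  (forall u v, Re (B u v) <= (rdot u u + rdot v v) / 2) ->
  exists2 T : bop H, (forall u v, dot (T u) v = B u v) &
    forall u, Re `|T u| <= Re `|u|.
Proof.
move=> Bl Br Bb.
have B0 u : B u 0 = 0.
  have := Br (-1) u 0 0; rewrite scaleN1r oppr0 addr0 rmorphN1 mulN1r.
  by rewrite addNr.
have /choice[T TB] : forall u, exists w, forall v, Re (B u v) = rdot w v.
  move=> u; apply: (riesz hilbertH (phi := fun v => Re (B u v)) (c := rdot u u)).
  - by move=> v w; rewrite -[v]scale1r Br rmorph1 mul1r scale1r ReD.
  - move=> t v; rewrite -[t%:C%C *: v]addr0 Br B0 addr0.
    by case: (B u v) => a b; rewrite /= oppr0 mul0r subr0.
  - exact: Bb.
have {}TB u v : dot (T u) v = B u v.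
  have ReT w : Re (dot (T u) w) = Re (B u w) by rewrite TB.
  apply/eqP; rewrite eq_complex ReT eqxx/=.
  have := ReT ('i%C *: v); rewrite dotZr -['i%C *: v]addr0 Br B0 addr0.
  by case: (dot (T u) v) => a b; case: (B u v) => a' b' /=;
    rewrite !mul0r !sub0r !mulN1r !opprK => ->.
have linT : linear T.
  move=> a u v; apply: dot_inj => // w.
  by rewrite TB Bl -!TB -dotZl -dotDl.
have leT u : Re `|T u| <= Re `|u|.
  rewrite -ler_sqr ?nnegrE ?Re_norm_ge0// -!(rdotE hilbertH).
  by have := Bb u (T u); rewrite -TB -/(rdot _ _); lra.
have contT : continuous T.
  move=> u; apply/(@cvgrPdist_lt _ _ _ (nbhs u)) => _ /posc_ex[e e0 ->].
  have e0' : 0 < e%:C%C :> R[i] by rewrite ltcR.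
  have := nbhsx_ballx u _ e0'; apply: filterS => v.
  rewrite -ball_normE /= !normc_lt; apply: le_lt_trans.
  by rewrite -[_ - T v]addrC -scaleN1r -linT scaleN1r addrC.
by exists (Bop (mem_set (conj linT contT))).
Qed.

End Operators.

(** * Compactness of the unit ball *)

(** Either the preimage of A or that of its complement belongs to F. *)
Lemma ultra_fmap (T U : Type) (f : T -> U) (F : set_system T) :
  UltraFilter F -> UltraFilter (f @ F).
Proof.
move=> UF; have FP : ProperFilter F by exact: ultra_proper.
split; first exact: fmap_proper_filter.
move=> G GF FG; apply/seteqP; split=> [A GA|]; last exact: FG.
have [//|FcA] := in_ultra_setVsetC (f @^-1` A) UF.
have /filter_ex[x []] : G (A `&` ~` A) by apply: filterI => //; exact: FG.
by [].
Qed.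

Lemma initial_cvg (S : choiceType) (T : topologicalType) (f : S -> T)
    (F : set_system S) (s : S) : Filter F ->
  f @ F --> f s -> F --> (s : initial_topology f).
Proof.
move=> FF fF A; rewrite nbhsE => -[B [[D oD <-] /= Ds] BA].
by apply: filterS BA _; apply: fF; exact: open_nbhs_nbhs.
Qed.

Lemma ptws_cvg (I : Type) (T : topologicalType)
    (F : set_system {ptws I -> T}) (f : {ptws I -> T}) : Filter F ->
  (forall i, g i @[g --> F] --> f i) -> F --> f.
Proof.
move=> FF Ff; apply/cvg_sup => i.
exact: (@initial_cvg _ _ (fun g : {ptws I -> T} => g i)).
Qed.

Section UnitBall.
Variables (R : realType) (H : completeNormedModType R[i]).
Variable dot : {dot H for Num.conj}.
Hypothesis hilbertH : norm_of_dot dot.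
Variable M : set (bop H).
Hypothesis vnM : von_neumann_algebra dot M.
Local Notation rdot := (rdot dot).
Local Notation C := (R[i]^o).
Local Notation X := (vna_ball dot M).

Definition op_of (x : X) : bop H := set_val x.

Lemma op_ofP (x : X) : M (op_of x).
Proof. by have [] := set_valP x. Qed.

Lemma op_of_le (x : X) u : Re `|op_of x u| <= Re `|u|.
Proof. by have [_ /opnorm_le1P] := set_valP x; apply. Qed.

Lemma op_of_surj (T : bop H) : M T -> (forall u, Re `|T u| <= Re `|u|) ->
  exists x, op_of x = T.
Proof.
move=> MT T1; have vT : T \in @vna_ball_set _ _ dot M.
  by apply/mem_set; split=> //; exact/opnorm_le1P.
by exists (exist _ T vT).
Qed.

Definition coef (u v : H) (x : X) : C := dot (op_of x u) v.

(** The bound does not depend on x, which makes the matrix coefficients along an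
ultrafilter converge, and series of them converge uniformly. *)
Lemma coef_amgm u v x :
  `|Re (coef u v x)| <= (rdot u u + rdot v v) / 2 /\
  `|Im (coef u v x)| <= (rdot u u + rdot v v) / 2.
Proof.
have op2 w : rdot (op_of x w) (op_of x w) <= rdot w w.
  by rewrite !(rdotE hilbertH) ler_sqr ?nnegrE ?Re_norm_ge0// op_of_le.
split; last rewrite /coef Im_dotE.
  apply: le_trans (rdot_amgm_norm hilbertH _ _) _.
  by rewrite ler_pM2r ?invr_gt0// lerD2r.
apply: le_trans (rdot_amgm_norm hilbertH _ _) _.
by rewrite rdot_iZ ler_pM2r ?invr_gt0// lerD2r.
Qed.

Lemma coef_continuous u v : continuous (coef u v).
Proof.
move=> x; apply: (@cvg_comp _ _ _ (fun x : X => (set_val x : wot dot))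
  (fun T : wot dot => dot ((T : bop H) u) v : C)).
  exact: (@initial_continuous _ _ (set_val : X -> wot dot)).
apply: (@cvg_comp _ _ _ (@matrix_coef _ _ dot) (fun f => f (u, v))).
  exact: (@initial_continuous _ _ (@matrix_coef _ _ dot)).
exact: (@proj_continuous _ (fun _ : H * H => C) (u, v)).
Qed.

Lemma wot_cvg (F : set_system (bop H)) (T : bop H) : Filter F ->
  (forall u v, (dot (S u) v : C) @[S --> F] --> (dot (T u) v : C)) ->
  F --> (T : wot dot).
Proof.
move=> FF FT; apply: initial_cvg.
by apply: ptws_cvg => -[u v]; exact: FT.
Qed.

(** Along an ultrafilter F the matrix coefficients of x tend to some B u v.
This is a bounded sesquilinear form, hence given by an operator T, which is a
contraction and the limit of F in the weak operator topology; M is closed for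
that topology, so T is in M. *)
Lemma vna_ball_compact : compact [set: X].
Proof.
rewrite compact_ultra => F UF _.
have FP : ProperFilter F by exact: ultra_proper.
have lim_real (f : X -> R) b : (forall x, `|f x| <= b) ->
    exists l, f @ F --> l /\ `|l| <= b.
  move=> fb; have cptb := @segment_compact R (- b) b.
  rewrite compact_ultra in cptb.
  have nF : \forall x \near F, `[- b, b]%classic (f x).
    by apply: nearW => x /=; rewrite in_itv/= -ler_norml.
  have [l [lb fl]] := cptb (f @ F) (ultra_fmap f UF) nF.
  by exists l; split=> //; move: lb; rewrite /= in_itv/= -ler_norml.
have /choice[B BP] : forall uv, exists b : C,
    coef uv.1 uv.2 @ F --> b /\ Re b <= (rdot uv.1 uv.1 + rdot uv.2 uv.2) / 2.
  move=> [u v] /=.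
  have [r [fr rb]] := lim_real _ _ (fun x => (coef_amgm u v x).1).
  have [i [fi _]] := lim_real _ _ (fun x => (coef_amgm u v x).2).
  exists (Complex r i); split; first exact: complex_cvg.
  by rewrite (le_trans (ler_norm _)).
have {BP} [BF Bb] : (forall u v, coef u v @ F --> B (u, v)) /\
    forall u v, Re (B (u, v)) <= (rdot u u + rdot v v) / 2.
  by split=> u v; have [] := BP (u, v).
have [|||T TB T1] := @sesquilinear_op _ _ _ hilbertH (fun u v => B (u, v)).
- move=> a u u' v; apply: (cvg_unique (@norm_hausdorff _ C) (BF _ _)).
  have -> : coef (a *: u + u') v = fun x => a * coef u v x + coef u' v x.
    by apply/funext => x; rewrite /coef bop_linear dotDl dotZl.
  by apply: cvgD; [apply: cvgMl_tmp|]; exact: BF.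
- move=> a u v v'; apply: (cvg_unique (@norm_hausdorff _ C) (BF _ _)).
  have -> : coef u (a *: v + v') =
      fun x => Num.conj a * coef u v x + coef u v' x.
    by apply/funext => x; rewrite /coef dotDr dotZr.
  by apply: cvgD; [apply: cvgMl_tmp|]; exact: BF.
- exact: Bb.
have opFT : op_of @ F --> (T : wot dot).
  by apply: wot_cvg => u v; rewrite TB; exact: BF.
have MT : M T.
  apply: (@closed_cvg _ (wot dot) F _ op_of M _ _ T opFT).
    exact: vna_closed vnM.
  by apply: nearW => x; exact: op_ofP.
have [x xT] := op_of_surj MT T1; exists x; split=> //=.
by apply: (@initial_cvg _ (wot dot) set_val); rewrite -/(op_of x) xT.
Qed.

(** * Normal functionals on the unit ball *)

Definition point_of (x : X) : set_type M :=
  exist _ (op_of x) (mem_set (op_ofP x)).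

(** On the ball the series defining f is dominated by (|xi n|^2 + |eta n|^2) /
2, so it is a uniformly convergent series of weakly continuous functions. *)
Lemma predual_continuous (f : set_type M -> C) :
  predual dot M f -> continuous (fun x : X => f (point_of x)).
Proof.
move=> [xi [eta [sxi seta fP]]].
pose a n := (rdot (xi n) (xi n) + rdot (eta n) (eta n)) / 2.
have ca : cvgn (series a).
  have -> : a = 2^-1 *: ((fun n => Re `|xi n| ^+ 2) +
      (fun n => Re `|eta n| ^+ 2)).
    by apply/funext => n; rewrite /a !(rdotE hilbertH) mulrC.
  by apply: is_cvg_seriesZ; exact: is_cvg_seriesD.
have part (rho : C -> R) : continuous rho -> {morph rho : z w / z + w} ->
    rho 0 = 0 -> (forall n x, `|rho (coef (xi n) (eta n) x)| <= a n) ->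
    continuous (fun x : X => rho (f (point_of x))).
  move=> crho rhoD rho0 rho_le.
  apply: (series_continuous _ rho_le ca) => [n x|x].
    by apply: (cvg_comp _ _ (@coef_continuous (xi n) (eta n) x)); exact: crho.
  apply: cvg_trans (cvg_comp _ _ (fP (point_of x)) (crho _)).
  apply: near_eq_cvg; apply: nearW => n /=.
  by rewrite /series/= (big_morph _ rhoD rho0).
have cRe : continuous (fun x : X => Re (f (point_of x))).
  apply: part (@Re_continuous R) (@ReD R) erefl _ => n x.
  exact: (coef_amgm (xi n) (eta n) x).1.
have cIm : continuous (fun x : X => Im (f (point_of x))).
  apply: part (@Im_continuous R) (@ImD R) erefl _ => n x.
  exact: (coef_amgm (xi n) (eta n) x).2.
by move=> x; apply: (@complex_cvg _ _ (nbhs x)); [exact: cRe|exact: cIm].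
Qed.

Lemma predual_bounded (f : set_type M -> C) : predual dot M f ->
  exists b : R, forall x : X, Re `|f (point_of x)| <= b.
Proof.
move=> /predual_continuous cf.
have cRe : continuous (fun x : X => Re (f (point_of x))).
  by move=> x; apply: (cvg_comp _ _ (cf x)); exact: Re_continuous.
have cIm : continuous (fun x : X => Im (f (point_of x))).
  by move=> x; apply: (cvg_comp _ _ (cf x)); exact: Im_continuous.
have [b _ fb] := continuous_bounded vna_ball_compact cRe.
have [c _ fc] := continuous_bounded vna_ball_compact cIm.
by exists (b + c) => x; rewrite (le_trans (norm_le_ReIm _))// lerD.
Qed.

(** The supremum in the definition of the norm of f - g is over a bounded set:
f and g are continuous on the compact ball. *)
Lemma predual_norm_ge (f g : set_type M -> C) (x : X) :
  predual dot M f -> predual dot M g ->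
  Re `|f (point_of x) - g (point_of x)| <= predual_norm (f - g).
Proof.
move=> /predual_bounded[b fb] /predual_bounded[c gc].
apply: ub_le_sup; last by exists (point_of x) => //; have [] := set_valP x.
exists (b + c) => _ [y /= /opnorm_le1P y1 <-].
have [z zy] := op_of_surj (set_valP y) y1.
have <- : point_of z = y by apply: val_inj.
have := ler_normB (f (point_of z)) (g (point_of z)).
rewrite normc_ReE [X in _ <= X + _]normc_ReE [X in _ <= _ + X]normc_ReE.
rewrite -rmorphD lecR => /le_trans; apply.
by rewrite lerD.
Qed.

Lemma cvg_series_single (K : numFieldType) (V : normedModType K) (a : nat -> V) :
  (forall n, (0 < n)%N -> a n = 0) -> series a @ \oo --> a 0%N.
Proof.
move=> a0; apply: cvg_near_cst; exists 1%N => // -[//|n] _ /=.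
rewrite /series/= big_nat_recl// big1 ?addr0// => i _; exact: a0.
Qed.

(** The sequences xi and eta are u and v followed by zeros. *)
Lemma predual_coef (u v : H) :
  predual dot M (fun x => dot ((set_val x : bop H) u) v).
Proof.
pose single w n : H := if n is 0%N then w else 0.
have sq w : square_summable (single w).
  apply: cvgP; apply: (@cvg_series_single _ R^o) => -[//|n] _ /=.
  by rewrite normr0 expr0n.
exists (single u), (single v); split=> // x.
apply: (@cvg_series_single _ C
  (fun n => dot (set_val x (single u n)) (single v n))).
by move=> [//|n] _; rewrite linear0r.
Qed.

Lemma point_of_continuous : continuous (point_of : X -> ultraweak dot M).
Proof.
move=> x; have FF : Filter (point_of @ nbhs x) by exact: fmap_filter.
apply: (@initial_cvg _ _ (@predual_eval _ _ dot M) _ _ FF).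
apply: ptws_cvg => -[f pf]; exact: (predual_continuous (set_mem pf)).
Qed.

(** Elements of the predual are weakly continuous on the ball, so the inclusion
of the ball into M with the ultraweak topology is continuous. *)
Lemma ball_of_closed (V : set (bop H)) : uw_closed_subspaces dot M V ->
  closed (ball_of dot M V).
Proof.
move=> [_ _ clV].
by have /continuous_closedP/(_ _ clV) := point_of_continuous.
Qed.

Lemma predual_dense_separates (D : set (set_type M -> C)) (x y : X) :
  D `<=` predual dot M ->
  (forall f, predual dot M f -> forall e : R, 0 < e ->
     exists2 g, D g & predual_norm (f - g) < e) ->
  (forall g, D g -> g (point_of x) = g (point_of y)) -> x = y.
Proof.
move=> Dp Ddense Dxy; apply: val_inj; apply: val_inj; apply/funext => u.
apply: (dot_inj hilbertH) => v.
pose f (z : set_type M) : C := dot ((set_val z : bop H) u) v.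
have pf : predual dot M f by exact: predual_coef.
apply/eqP; rewrite -subr_eq0 -normr_eq0 normc_ReE; apply/eqP.
suff -> : Re `|dot ((op_of x) u) v - dot ((op_of y) u) v| = 0 by [].
apply/eqP; rewrite eq_le Re_norm_ge0 andbT; apply/ler_addgt0Pr => e e0.
have e20 : 0 < e / 2 by rewrite divr_gt0.
have [g Dg fg] := Ddense f pf _ e20.
have gx := predual_norm_ge x pf (Dp _ Dg).
have gy := predual_norm_ge y pf (Dp _ Dg).
rewrite add0r -lecR -normc_ReE.
have -> : dot ((op_of x) u) v - dot ((op_of y) u) v =
    (f (point_of x) - g (point_of x)) - (f (point_of y) - g (point_of y)).
  by rewrite (Dxy g Dg) opprB addrA subrK.
rewrite (le_trans (ler_normB _ _))//.
rewrite [X in X + _]normc_ReE [X in _ + X]normc_ReE -rmorphD lecR.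
by move: gx gy fg; lra.
Qed.

Lemma ball_of_midpoint (V : set (bop H)) (x y : X) :
  uw_closed_subspaces dot M V -> ball_of dot M V x -> ball_of dot M V y ->
  exists2 m, ball_of dot M V m &
    forall f, predual dot M f ->
      f (point_of m) = 2^-1 * (f (point_of x) + f (point_of y)).
Proof.
move=> [VM [V0 Vlin] _] Vx Vy.
have [m mE] : exists m, op_of m = 2^-1 *: op_of x + (2^-1 *: op_of y + 0).
  apply: op_of_surj => [|u]; first exact: VM _ (Vlin _ _ _ Vx (Vlin _ _ _ Vy V0)).
  have le1 (z : X) : `|op_of z u| <= `|u|.
    by rewrite (normc_ReE u) normc_le op_of_le.
  rewrite -normc_le -normc_ReE addr0.
  rewrite (le_trans (ler_normD (2^-1 *: op_of x u) (2^-1 *: op_of y u)))//.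
  rewrite !normrZ -mulrDr ger0_norm ?invr_ge0// ler_pdivrMl//.
  by rewrite mulr_natl mulr2n lerD.
exists m => [|f [xi [eta [_ _ fP]]]].
  suff : V (op_of m) by [].
  by rewrite mE; exact: (Vlin _ _ _ Vx (Vlin _ _ _ Vy V0)).
apply: (cvg_unique (@norm_hausdorff _ C) (fP _)).
have -> : series (fun n => dot (set_val (point_of m) (xi n)) (eta n) : C) =
    fun n => 2^-1 *
      (series (fun n => dot (set_val (point_of x) (xi n)) (eta n) : C) n +
       series (fun n => dot (set_val (point_of y) (xi n)) (eta n) : C) n).
  apply/funext => n; rewrite /series/= -big_split/= mulr_sumr.
  apply: eq_bigr => i _; rewrite -[set_val (point_of m)]/(op_of m) mE addr0.
  by rewrite mulrDr -!dotZl -dotDl.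
by apply: cvgMl_tmp; apply: cvgD; exact: fP.
Qed.

Lemma ball_of_nonempty (V : set (bop H)) : uw_closed_subspaces dot M V ->
  ball_of dot M V !=set0.
Proof.
move=> [VM [V0 _] _]; have [x x0] : exists x, op_of x = 0.
  apply: op_of_surj => [|u]; first exact: VM.
  by rewrite -[(0 : bop H) u]/(0 : H) normr0 Re_norm_ge0.
by exists x; rewrite /ball_of/= -/(op_of x) x0.
Qed.

End UnitBall.

(** * Continuous dense selections on the Grassmannian *)

Theorem proposition6p1 (R : realType) (H : completeNormedModType R[i])
    (dot : {dot H for Num.conj}) (hilbertH : norm_of_dot dot)
    (M : set (bop H)) (vnM : von_neumann_algebra dot M)
    (sepM : separable_predual dot M) :
  exists x : nat -> grassmannian dot M -> vna_ball dot M,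
    (forall n, continuous (x n)) /\
    forall V : grassmannian dot M,
      (forall n, ball_of dot M (space_of V) (x n V)) /\
      ball_of dot M (space_of V) `<=` closure (range (fun n => x n V)).
Proof.
have [D [cD Dp] Ddense] := sepM.
have [z0 _] : exists z : vna_ball dot M, op_of z = 0.
  apply: op_of_surj => [|u]; first exact: (vna_subspace vnM).1.
  by rewrite -[(0 : bop H) u]/(0 : H) normr0 Re_norm_ge0.
have [g0 Dg0 _] := Ddense _ (predual_coef dot M 0 0) _ (@ltr01 R).
have /pcard_surjP[g' gD] := cD.
(* The enumeration g' of D may take values outside D: these are replaced by an
   element of D. *)
pose g n := if pselect (D (g' n)) then g' n else g0.
have Dg n : D (g n) by rewrite /g; case: pselect.
have cg n := predual_continuous hilbertH (Dp _ (Dg n)).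
pose h n (x : vna_ball dot M) : R :=
  if odd n then Im (g n./2 (point_of x)) else Re (g n./2 (point_of x)).
apply: (@dense_continuous_selections R (vna_ball dot M)
  (vna_ball_compact hilbertH vnM) (grassmannian dot M)
  (@ball_map _ _ dot M) h z0).
- exact: initial_continuous.
- by move=> V; apply: ball_of_closed => //; exact: set_valP.
- by move=> V; apply: ball_of_nonempty; exact: (set_valP V).
- move=> n x; rewrite /h; case: (odd n).
    by apply: (cvg_comp _ _ (cg _ x)); exact: Im_continuous.
  by apply: (cvg_comp _ _ (cg _ x)); exact: Re_continuous.
- move=> x y hxy; apply: (predual_dense_separates hilbertH vnM Dp Ddense) => d Dd.
  have [n _ gn] := gD d Dd.
  have <- : g n = d by rewrite /g; case: pselect; rewrite gn.
  apply/eqP; rewrite eq_complex; apply/andP; split; apply/eqP.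
    by have := hxy n.*2; rewrite /h odd_double doubleK.
  by have := hxy n.*2.+1; rewrite /h /= odd_double uphalf_double.
- move=> V x y Vx Vy.
  have [m Vm mE] := ball_of_midpoint (set_valP V) Vx Vy; exists m => // n.
  rewrite /h; case: (odd n); rewrite (mE _ (Dp _ (Dg _))).
    by rewrite Im_half ImD.
  by rewrite Re_half ReD.
Qed.
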